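(* Let $(\mathbb A,\cdot_{\mathbb A})$, $\mathbb A=A\oplus B$, be a quasi-twilled associative algebra with components $(A_\mu,B_\nu,\vartriangleright,\vartriangleleft,\rightharpoonup,\leftharpoonup,\theta)$, and let $D:A\to B$ be a strong deformation map in it. (i) The vector space $A$ with the multiplication $\mu_D:A\times A\to A$, $(a,b)\mapsto a\cdot_D b:=a\cdot_A b+a\leftharpoonup D(b)+D(a)\rightharpoonup b$, is an associative algebra (denoted $A_D$). (ii) The tuple $(A_{\mu_D},B_\nu,\vartriangleright_D,\vartriangleleft_D,\rightharpoonup,\leftharpoonup)$ is a matched pair of associative algebras, where for $a\in A$, $x\in B$, $$a\vartriangleright_D x:=a\vartriangleright x+D(a)\cdot_B x-D(a\leftharpoonup x),\qquad x\vartriangleleft_D a:=x\vartriangleleft a+x\cdot_B D(a)-D(x\rightharpoonup a).$$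
   Context: All vector spaces are over a fixed field; associative algebras are not assumed unital. A quasi-twilled associative algebra is an associative algebra $(\mathbb A,\cdot_{\mathbb A})$ with a fixed vector space decomposition $\mathbb A=A\oplus B$ such that $B$ is a subalgebra. Its multiplication has the form $(a,x)\cdot_{\mathbb A}(b,y)=(a\cdot_A b+a\leftharpoonup y+x\rightharpoonup b,\ x\cdot_B y+a\vartriangleright y+x\vartriangleleft b+\theta(a,b))$ for unique bilinear maps $\mu=\cdot_A:A\times A\to A$, $\nu=\cdot_B:B\times B\to B$, $\vartriangleright:A\times B\to B$, $\vartriangleleft:B\times A\to B$, $\rightharpoonup:B\times A\to A$, $\leftharpoonup:A\times B\to A$, $\theta:A\times A\to B$, its components; one writes it as the tuple $(A_\mu,B_\nu,\vartriangleright,\vartriangleleft,\rightharpoonup,\leftharpoonup,\theta)$. A strong deformation map is a linear map $D:A\to B$ with $D(a\cdot_A b+a\leftharpoonup D(b)+D(a)\rightharpoonup b)=D(a)\cdot_B D(b)+a\vartriangleright D(b)+D(a)\vartriangleleft b+\theta(a,b)$ for all $a,b\in A$. A matched pair of associative algebras is a tuple $(A_\mu,B_\nu,\vartriangleright,\vartriangleleft,\rightharpoonup,\leftharpoonup)$ of two associative algebras $A_\mu,B_\nu$ and bilinear maps $\vartriangleright:A\times B\to B$, $\vartriangleleft:B\times A\to B$, $\rightharpoonup:B\times A\to A$, $\leftharpoonup:A\times B\to A$ such that $(B,\vartriangleright,\vartriangleleft)$ is an $A_\mu$-bimodule, $(A,\rightharpoonup,\leftharpoonup)$ is a $B_\nu$-bimodule,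 and the multiplication $(a,x)\Join(b,y)=(a\cdot_A b+a\leftharpoonup y+x\rightharpoonup b,\ x\cdot_B y+a\vartriangleright y+x\vartriangleleft b)$ on $A\oplus B$ is associative. *)

(* Defs.v *)
From HB Require Import structures.
From mathcomp Require Import all_boot all_order all_algebra.
Set Implicit Arguments.
Unset Strict Implicit.
Unset Printing Implicit Defensive.
Import GRing.Theory.
Local Open Scope ring_scope.

Definition bilinear_map (K : fieldType) (U V W : lmodType K)
  (f : U -> V -> W) : Prop := bilinear_for *:%R *:%R f.

(* Not assumed unital, so mathcomp's algebra structures do not apply. *)
Record assoc_algebra (K : fieldType) (V : lmodType K) (mul : V -> V -> V) :
    Prop := AssocAlgebra {
  assoc_bilinear : bilinear_map mul;
  assoc_mulA : associative mul }.

(* [rtri], [ltri] are the left action V x M -> M and right action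
   M x V -> M; no unit acts. *)
Record bimodule (K : fieldType) (V M : lmodType K) (mul : V -> V -> V)
    (rtri : V -> M -> M) (ltri : M -> V -> M) : Prop := Bimodule {
  bimod_l_bilinear : bilinear_map rtri;
  bimod_r_bilinear : bilinear_map ltri;
  bimod_lA : forall a b x, rtri (mul a b) x = rtri a (rtri b x);
  bimod_rA : forall x a b, ltri x (mul a b) = ltri (ltri x a) b;
  bimod_lrA : forall a x b, ltri (rtri a x) b = rtri a (ltri x b) }.

(* The fixed decomposition is the external direct sum A (+) B, realized on the
   product module A * B, with B embedded as the pairs (0, x). *)
Record quasi_twilled (K : fieldType) (A B : lmodType K)
    (mulAB : A * B -> A * B -> A * B) : Prop := QuasiTwilled {
  qt_assoc : assoc_algebra mulAB;
  qt_subalg : forall x y : B, (mulAB (0, x) (0, y)).1 = 0 }.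

(* In all tuples below, [rtri] is the triangle A x B -> B, [ltri] the triangle
   B x A -> B, [rharp] the right-pointing harpoon B x A -> A and [lharp] the
   left-pointing harpoon A x B -> A. *)
Record components (K : fieldType) (A B : lmodType K)
    (mulAB : A * B -> A * B -> A * B)
    (mu : A -> A -> A) (nu : B -> B -> B)
    (rtri : A -> B -> B) (ltri : B -> A -> B)
    (rharp : B -> A -> A) (lharp : A -> B -> A)
    (theta : A -> A -> B) : Prop := Components {
  comp_mu : bilinear_map mu;
  comp_nu : bilinear_map nu;
  comp_rtri : bilinear_map rtri;
  comp_ltri : bilinear_map ltri;
  comp_rharp : bilinear_map rharp;
  comp_lharp : bilinear_map lharp;
  comp_theta : bilinear_map theta;
  comp_mulE : forall (a b : A) (x y : B),
    mulAB (a, x) (b, y) =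
      (mu a b + lharp a y + rharp x b,
       nu x y + rtri a y + ltri x b + theta a b) }.

Definition strong_deformation_map (K : fieldType) (A B : lmodType K)
    (mu : A -> A -> A) (nu : B -> B -> B)
    (rtri : A -> B -> B) (ltri : B -> A -> B)
    (rharp : B -> A -> A) (lharp : A -> B -> A)
    (theta : A -> A -> B) (D : {linear A -> B}) : Prop :=
  forall a b : A,
    D (mu a b + lharp a (D b) + rharp (D a) b) =
    nu (D a) (D b) + rtri a (D b) + ltri (D a) b + theta a b.

Definition bowtie_mul (K : fieldType) (A B : lmodType K)
    (mu : A -> A -> A) (nu : B -> B -> B)
    (rtri : A -> B -> B) (ltri : B -> A -> B)
    (rharp : B -> A -> A) (lharp : A -> B -> A) (p q : A * B) : A * B :=
  (mu p.1 q.1 + lharp p.1 q.2 + rharp p.2 q.1,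
   nu p.2 q.2 + rtri p.1 q.2 + ltri p.2 q.1).

Record matched_pair (K : fieldType) (A B : lmodType K)
    (mu : A -> A -> A) (nu : B -> B -> B)
    (rtri : A -> B -> B) (ltri : B -> A -> B)
    (rharp : B -> A -> A) (lharp : A -> B -> A) : Prop := MatchedPair {
  mp_algA : assoc_algebra mu;
  mp_algB : assoc_algebra nu;
  mp_bimodB : bimodule mu rtri ltri;
  mp_bimodA : bimodule nu rharp lharp;
  mp_assoc : associative (bowtie_mul mu nu rtri ltri rharp lharp) }.

Definition mulD (K : fieldType) (A B : lmodType K) (mu : A -> A -> A)
    (rharp : B -> A -> A) (lharp : A -> B -> A) (D : A -> B) (a b : A) : A :=
  mu a b + lharp a (D b) + rharp (D a) b.

Definition rtriD (K : fieldType) (A B : lmodType K) (nu : B -> B -> B)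
    (rtri : A -> B -> B) (lharp : A -> B -> A) (D : A -> B)
    (a : A) (x : B) : B :=
  rtri a x + nu (D a) x - D (lharp a x).

Definition ltriD (K : fieldType) (A B : lmodType K) (nu : B -> B -> B)
    (ltri : B -> A -> B) (rharp : B -> A -> A) (D : A -> B)
    (x : B) (a : A) : B :=
  ltri x a + nu x (D a) - D (rharp x a).

Lemma components_exist (K : fieldType) (A B : lmodType K)
    (mulAB : A * B -> A * B -> A * B) : quasi_twilled mulAB ->
  components mulAB
    (fun a b => (mulAB (a, 0) (b, 0)).1) (fun x y => (mulAB (0, x) (0, y)).2)
    (fun a y => (mulAB (a, 0) (0, y)).2) (fun x b => (mulAB (0, x) (b, 0)).2)
    (fun x b => (mulAB (0, x) (b, 0)).1) (fun a y => (mulAB (a, 0) (0, y)).1)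
    (fun a b => (mulAB (a, 0) (b, 0)).2).
Proof.
move=> [[[Hl Hr] _] HB].
have Zl k p q r : mulAB (k *: p + q) r = k *: mulAB p r + mulAB q r.
  exact: Hl.
have Zr k p q r : mulAB p (k *: q + r) = k *: mulAB p q + mulAB p r.
  exact: Hr.
have Dl p q r : mulAB (p + q) r = mulAB p r + mulAB q r.
  by have := Zl 1 p q r; rewrite !scale1r.
have Dr p q r : mulAB p (q + r) = mulAB p q + mulAB p r.
  by have := Zr 1 p q r; rewrite !scale1r.
have EA (k : K) (a b : A) : (k *: a + b, 0 : B) = k *: (a, 0) + (b, 0).
  by congr pair; rewrite /= ?scaler0 ?addr0.
have EB (k : K) (x y : B) : (0 : A, k *: x + y) = k *: (0, x) + (0, y).
  by congr pair; rewrite /= ?scaler0 ?addr0.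
have E (a : A) (x : B) : (a, x) = (a, 0) + (0, x).
  by congr pair; rewrite /= ?addr0 ?add0r.
split; try by split=> ? k ? ? /=; rewrite ?EA ?EB ?Zl ?Zr.
move=> a b x y; rewrite (E a x) (E b y) Dl !Dr.
congr pair; rewrite /=; first by rewrite HB addr0.
by rewrite (AC (2*2) (4*2*3*1)%AC).
Qed.

(* Main.v *)
Require Import Defs.
From mathcomp Require Import all_boot all_order all_algebra.
Set Implicit Arguments.
Unset Strict Implicit.
Unset Printing Implicit Defensive.
Import GRing.Theory.
Local Open Scope ring_scope.

(** The graph of [D] is a complement of [B] in [A * B], so the shear
    [(a, x) |-> (a, x + D a)] transports the associative product to a product
    that again has [B] as a subalgebra. The components of the transported
    product are exactly [mulD], [nu], [rtriD], [ltriD], [rharp], [lharp],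
    together with a component [A -> A -> B] whose value at [(a, b)] is the
    defect of [D] from being a strong deformation map, hence zero
    ([shear_bowtieD]). The transported product is thus the bowtie product of
    the twisted data, which is therefore associative.

    Conversely, as soon as six bilinear maps have an associative bowtie product,
    they form a matched pair: every algebra and bimodule axiom is associativity
    on triples of vectors of [A] and [B] ([matched_pair_bowtie]). *)

Section BilinearMaps.
Variables (K : fieldType) (U V W : lmodType K).
Implicit Types f g : U -> V -> W.

Lemma bilinear_map0l f : bilinear_map f -> forall x, f 0 x = 0.
Proof.
by case=> fl _ x; have /= := fl x (-1) 0 0; rewrite scaler0 addr0 scaleN1r addNr.
Qed.

Lemma bilinear_map0r f : bilinear_map f -> forall u, f u 0 = 0.
Proof.
by case=> _ fr u; have /= := fr u (-1) 0 0; rewrite scaler0 addr0 scaleN1r addNr.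
Qed.

Lemma bilinear_mapDl f :
  bilinear_map f -> forall u v x, f (u + v) x = f u x + f v x.
Proof. by case=> fl _ u v x; have /= := fl x 1 u v; rewrite !scale1r. Qed.

Lemma bilinear_mapDr f :
  bilinear_map f -> forall u x y, f u (x + y) = f u x + f u y.
Proof. by case=> _ fr u x y; have /= := fr u 1 x y; rewrite !scale1r. Qed.

Lemma bilinear_map_add f g :
  bilinear_map f -> bilinear_map g -> bilinear_map (fun u x => f u x + g u x).
Proof.
case=> fl fr [gl gr]; split=> [x k u v|u k x y] /=.
  by have /= -> := fl x k u v; have /= -> := gl x k u v; rewrite scalerDr addrACA.
by have /= -> := fr u k x y; have /= -> := gr u k x y; rewrite scalerDr addrACA.
Qed.

Lemma bilinear_map_opp f : bilinear_map f -> bilinear_map (fun u x => - f u x).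
Proof.
case=> fl fr; split=> [x k u v|u k x y] /=.
  by have /= -> := fl x k u v; rewrite opprD scalerN.
by have /= -> := fr u k x y; rewrite opprD scalerN.
Qed.

Lemma bilinear_map_compl (U' : lmodType K) f (h : {linear U' -> U}) :
  bilinear_map f -> bilinear_map (fun u x => f (h u) x).
Proof.
case=> fl fr; split=> [x k u v|u k x y] /=; last exact: fr.
by rewrite linearP; apply: fl.
Qed.

Lemma bilinear_map_compr (V' : lmodType K) f (h : {linear V' -> V}) :
  bilinear_map f -> bilinear_map (fun u x => f u (h x)).
Proof.
case=> fl fr; split=> [x k u v|u k x y] /=; first exact: fl.
by rewrite linearP; apply: fr.
Qed.

Lemma bilinear_map_comp (W' : lmodType K) f (h : {linear W -> W'}) :
  bilinear_map f -> bilinear_map (fun u x => h (f u x)).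
Proof.
case=> fl fr; split=> [x k u v|u k x y] /=.
  by have /= -> := fl x k u v; rewrite linearP.
by have /= -> := fr u k x y; rewrite linearP.
Qed.

End BilinearMaps.

Lemma matched_pair_bowtie (K : fieldType) (A B : lmodType K)
    (mu : A -> A -> A) (nu : B -> B -> B)
    (rtri : A -> B -> B) (ltri : B -> A -> B)
    (rharp : B -> A -> A) (lharp : A -> B -> A) :
  bilinear_map mu -> bilinear_map nu -> bilinear_map rtri ->
  bilinear_map ltri -> bilinear_map rharp -> bilinear_map lharp ->
  associative (bowtie_mul mu nu rtri ltri rharp lharp) ->
  matched_pair mu nu rtri ltri rharp lharp.
Proof.
move=> bmu bnu brt blt brh blh mA.
have z0 := (bilinear_map0l bmu, bilinear_map0r bmu,
            bilinear_map0l bnu, bilinear_map0r bnu,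
            bilinear_map0l brt, bilinear_map0r brt,
            bilinear_map0l blt, bilinear_map0r blt,
            bilinear_map0l brh, bilinear_map0r brh,
            bilinear_map0l blh, bilinear_map0r blh).
have mA1 p q r := congr1 fst (mA p q r).
have mA2 p q r := congr1 snd (mA p q r).
split=> //; split=> //.
- by move=> a b c; have := mA1 (a, 0) (b, 0) (c, 0);
    rewrite /bowtie_mul /= !(z0, addr0, add0r).
- by move=> x y z; have := mA2 (0, x) (0, y) (0, z);
    rewrite /bowtie_mul /= !(z0, addr0, add0r).
- by move=> a b x; have := mA2 (a, 0) (b, 0) (0, x);
    rewrite /bowtie_mul /= !(z0, addr0, add0r).
- by move=> x a b; have := mA2 (0, x) (a, 0) (b, 0);
    rewrite /bowtie_mul /= !(z0, addr0, add0r).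
- by move=> a x b; have := mA2 (a, 0) (0, x) (b, 0);
    rewrite /bowtie_mul /= !(z0, addr0, add0r).
- by move=> x y a; have := mA1 (0, x) (0, y) (a, 0);
    rewrite /bowtie_mul /= !(z0, addr0, add0r).
- by move=> a x y; have := mA1 (a, 0) (0, x) (0, y);
    rewrite /bowtie_mul /= !(z0, addr0, add0r).
- by move=> x a y; have := mA1 (0, x) (a, 0) (0, y);
    rewrite /bowtie_mul /= !(z0, addr0, add0r).
Qed.

(** The linear automorphism of [A * B] that fixes [B] and maps [A] onto the
    graph of [D]. *)
Definition shear (A B : zmodType) (D : A -> B) (p : A * B) : A * B :=
  (p.1, p.2 + D p.1).

Lemma shear_inj (A B : zmodType) (D : A -> B) : injective (shear D).
Proof. by move=> [a x] [b y] [-> /addIr->]. Qed.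

Section StrongDeformationMap.
Variables (K : fieldType) (A B : lmodType K) (mulAB : A * B -> A * B -> A * B).
Variables (mu : A -> A -> A) (nu : B -> B -> B).
Variables (rtri : A -> B -> B) (ltri : B -> A -> B).
Variables (rharp : B -> A -> A) (lharp : A -> B -> A) (theta : A -> A -> B).
Variable D : {linear A -> B}.
Hypothesis cAB : components mulAB mu nu rtri ltri rharp lharp theta.

Let bowtieD := bowtie_mul (mulD mu rharp lharp D) nu
  (rtriD nu rtri lharp D) (ltriD nu ltri rharp D) rharp lharp.

Lemma mulD_bilinear : bilinear_map (mulD mu rharp lharp D).
Proof.
case: cAB => bmu _ _ _ brh blh _ _.
exact: bilinear_map_add (bilinear_map_add bmu (bilinear_map_compr _ blh))
  (bilinear_map_compl _ brh).
Qed.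

Lemma rtriD_bilinear : bilinear_map (rtriD nu rtri lharp D).
Proof.
case: cAB => _ bnu brt _ _ blh _ _.
exact: bilinear_map_add (bilinear_map_add brt (bilinear_map_compl _ bnu))
  (bilinear_map_opp (bilinear_map_comp _ blh)).
Qed.

Lemma ltriD_bilinear : bilinear_map (ltriD nu ltri rharp D).
Proof.
case: cAB => _ bnu _ blt brh _ _ _.
exact: bilinear_map_add (bilinear_map_add blt (bilinear_map_compr _ bnu))
  (bilinear_map_opp (bilinear_map_comp _ brh)).
Qed.

Hypothesis sD : strong_deformation_map mu nu rtri ltri rharp lharp theta D.

(** The strong deformation equation enters only here, to make the component
    [A -> A -> B] of the transported product vanish. *)
Lemma shear_bowtieD : {morph shear D : p q / bowtieD p q >-> mulAB p q}.
Proof.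
case: cAB => bmu bnu brt blt brh blh _ mulE [a x] [b y].
rewrite /shear mulE /bowtieD /bowtie_mul /=.
rewrite !(bilinear_mapDl bnu, bilinear_mapDr bnu,
  bilinear_mapDr brt, bilinear_mapDl blt, bilinear_mapDl brh,
  bilinear_mapDr blh).
congr pair; first by rewrite /mulD (ACl (1*(4*2)*(5*3))%AC).
have -> : D (mulD mu rharp lharp D a b + lharp a y + rharp x b) =
    nu (D a) (D b) + rtri a (D b) + ltri (D a) b + theta a b
      + D (lharp a y) + D (rharp x b).
  by rewrite !raddfD; congr (_ + _ + _); rewrite -!raddfD; apply: sD.
(* After regrouping, [D (lharp a y)] and [D (rharp x b)] cancel against the
   correction terms of [rtriD] and [ltriD]. *)
rewrite /rtriD /ltriD (AC (1*3*3*6)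
  (((1*6)*(3*8)*(2*9)*(5*10)*11)*(12*4)*(13*7)))%AC /=.
by rewrite !subrr !addr0.
Qed.

Lemma bowtieD_assoc : associative mulAB -> associative bowtieD.
Proof.
by move=> mA p q r; apply: (@shear_inj _ _ D); rewrite !shear_bowtieD mA.
Qed.

End StrongDeformationMap.

Theorem proposition4p8 (K : fieldType) (A B : lmodType K)
    (mulAB : A * B -> A * B -> A * B)
    (mu : A -> A -> A) (nu : B -> B -> B)
    (rtri : A -> B -> B) (ltri : B -> A -> B)
    (rharp : B -> A -> A) (lharp : A -> B -> A)
    (theta : A -> A -> B) (D : {linear A -> B}) :
  quasi_twilled mulAB ->
  components mulAB mu nu rtri ltri rharp lharp theta ->
  strong_deformation_map mu nu rtri ltri rharp lharp theta D ->
  assoc_algebra (mulD mu rharp lharp D) /\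
  matched_pair (mulD mu rharp lharp D) nu
    (rtriD nu rtri lharp D) (ltriD nu ltri rharp D) rharp lharp.
Proof.
move=> [[_ mA] _] cAB sD.
have mp : matched_pair (mulD mu rharp lharp D) nu
    (rtriD nu rtri lharp D) (ltriD nu ltri rharp D) rharp lharp.
  case: (cAB) => _ bnu _ _ brh blh _ _.
  apply: matched_pair_bowtie => //.
  - exact: mulD_bilinear cAB.
  - exact: rtriD_bilinear cAB.
  - exact: ltriD_bilinear cAB.
  - exact: bowtieD_assoc cAB sD mA.
by split=> //; case: mp.
Qed.
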